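(* Let $X$ be a compact metric space and let $A$ be a uniform algebra on $X$ (so that $X$ is the character space of $A$). Suppose that $Y$ is a dense subset of $X$ such that $A$ has bounded relative units at $x$ for each $x \in Y$. Then $A_{lc}$ is dense in $A$ (with respect to the uniform norm).
   Context: Conventions: $C(X)$ is the algebra of all continuous complex-valued functions on a compact Hausdorff space $X$, with uniform norm $\|f\|_\infty = \sup_{x\in X}|f(x)|$. A uniform algebra $A$ on $X$ is a uniformly closed subalgebra of $C(X)$ which contains the constants and separates the points of $X$, and such that $X$ is the character space of $A$, i.e. every character of $A$ (nonzero multiplicative linear functional $A\to\mathbb{C}$) is evaluation at some point of $X$. For $x\in X$, $J_x := \{f\in A : f^{-1}(\{0\}) \text{ is a neighbourhood of } x\}$. For $C\ge 1$, $A$ has bounded relative units at $x$ with bound $C$ if for every compact $E\subseteq X\setminus\{x\}$ there is $f\in J_x$ with $\|f\|_\infty\le C$ and $f(E)\subseteq\{1\}$. $A$ has bounded relative units at $x$ if it has bounded relative units at $x$ with bound $C$ for some $C\ge 1$. $A_{lc} := \{f\in A : \text{there exists a dense open set } U\subseteq X \text{ with } f \text{ locally constant on } U\}$ (the set $U$ may depend on $f$). *)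

(* Defs.v *)
From HB Require Import structures.
From mathcomp Require Import all_boot all_order all_algebra.
From mathcomp Require Import complex.
From mathcomp Require Import all_classical all_reals.
From mathcomp Require Import topology normedtype.

Set Implicit Arguments.
Unset Strict Implicit.
Unset Printing Implicit Defensive.

Import Order.TTheory GRing.Theory Num.Theory.
Import numFieldNormedType.Exports.

Local Open Scope classical_set_scope.
Local Open Scope complex_scope.
Local Open Scope ring_scope.

Section sup_norm.
Context {R : realType}.

(* [ComplexField.Normc.normc] is the [R]-valued modulus: the library's [`|z|]
   on [R[i]] takes its values in [R[i]].  [sup] defaults to 0 on
   unbounded and on empty sets; the former do not occur for continuous [f] on
   a compact space, and the latter only for empty [X]. *)
Definition sup_norm {X : Type} (f : X -> R[i]^o) : R :=
  sup (range (fun x => ComplexField.Normc.normc (f x))).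

End sup_norm.

Section uniform_algebra.
Context {R : realType} {X : topologicalType}.
Implicit Types (A : set (X -> R[i]^o)) (E U : set X) (x y : X) (C : R).

(* A functional on [A] is encoded as a function on all of [X -> R[i]^o], of
   which only the values on [A] matter. *)
Record is_character A (phi : (X -> R[i]^o) -> R[i]) : Prop := IsCharacter {
  characterD : forall f g, A f -> A g -> phi (f \+ g) = phi f + phi g ;
  characterZ : forall (c : R[i]) f, A f -> phi (c \*: f) = c * phi f ;
  characterM : forall f g, A f -> A g -> phi (f \* g) = phi f * phi g ;
  character_neq0 : exists2 f, A f & phi f <> 0 }.

(* [closed] refers to the topology of uniform convergence on [X]; on continuous
   functions over a compact space this is the topology of [sup_norm], see
   [closure_sup_normP]. *)
Record is_uniform_algebra A : Prop := IsUniformAlgebra {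
  ualg_continuous : forall f, A f -> continuous f ;
  ualg_cst : forall c : R[i], A (cst c) ;
  ualgD : forall f g, A f -> A g -> A (f \+ g) ;
  ualgZ : forall (c : R[i]) f, A f -> A (c \*: f) ;
  ualgM : forall f g, A f -> A g -> A (f \* g) ;
  ualg_closed : closed (A : set {uniform X -> R[i]^o}) ;
  ualg_separates : forall x y, x <> y -> exists2 f, A f & f x <> f y ;
  ualg_character : forall phi, is_character A phi ->
    exists x, forall f, A f -> phi f = f x }.

Definition J A x : set (X -> R[i]^o) :=
  [set f | A f /\ nbhs x (f @^-1` [set 0])].

Definition has_bounded_relative_units_with A x C : Prop :=
  forall E, compact E -> E `<=` [set~ x] ->
    exists f, [/\ J A x f, sup_norm f <= C & f @` E `<=` [set 1]].

Definition has_bounded_relative_units A x : Prop :=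
  exists2 C, 1 <= C & has_bounded_relative_units_with A x C.

Definition locally_constant_on U (f : X -> R[i]^o) : Prop :=
  forall x, U x -> \forall y \near x, f y = f x.

Definition A_lc A : set (X -> R[i]^o) :=
  [set f | A f /\ exists U, [/\ open U, dense U & locally_constant_on U f]].

End uniform_algebra.

Section sup_norm_theory.
Context {R : realType} {X : topologicalType}.
Implicit Types (f g h : X -> R[i]^o) (S : set (X -> R[i]^o)).
Local Notation normc := ComplexField.Normc.normc.

Lemma lt_normc (z : R[i]) (e : R) : (`|z| < e%:C) = (normc z < e).
Proof. by rewrite -ltcR. Qed.

Lemma ler_dist_normc (z w : R[i]) : `|normc z - normc w| <= normc (z - w).
Proof.
have tri (a b : R[i]) : normc a - normc b <= normc (a - b).
  by rewrite lerBlDr -{1}(subrK b a); exact: (le_normcD (a - b) b).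
rewrite ler_norml tri andbT lerNl opprB.
by rewrite -(normcN (z - w : Rcomplex R)) opprB; exact: tri.
Qed.

Lemma continuous_normc h : continuous h -> continuous (fun x => normc (h x)).
Proof.
move=> ch x; apply/(@cvgrPdist_lt R R^o) => e e0.
have e0' : (0 : R[i]) < e%:C by rewrite ltcR.
have := ch x => /(@cvgrPdist_lt _ R[i]^o) /(_ _ e0').
apply: filterS => y; rewrite lt_normc; apply: le_lt_trans.
exact: ler_dist_normc.
Qed.

Lemma normc_le_sup_norm h x :
  compact [set: X] -> continuous h -> normc (h x) <= sup_norm h.
Proof.
move=> cX ch; apply: sup_upper_bound; last by exists x.
apply: compact_has_sup; first by exists (normc (h x)); exists x.
apply: continuous_compact => //.
by apply: continuous_subspaceT; exact: continuous_normc.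
Qed.

Lemma sup_norm_le h (e : R) :
  0 <= e -> (forall x, normc (h x) <= e) -> sup_norm h <= e.
Proof.
move=> e0 he; have [[x _]|X0] := pselect ([set: X] !=set0).
  by apply: ge_sup; [exists (normc (h x)); exists x|move=> _ [y _ <-]].
rewrite /sup_norm sup_out// => -[[_ [x _ _]] _].
by apply: X0; exists x.
Qed.

Lemma closure_sup_normP S f : compact [set: X] ->
  (forall g, S g -> continuous g) -> continuous f ->
  closure (S : set {uniform X -> R[i]^o}) f <->
  forall e : R, 0 < e -> exists2 g, S g & sup_norm (f \- g) < e.
Proof.
move=> cX cS cf; split=> [clf e e0|Sf B].
  have e20 : 0 < e / 2 by rewrite divr_gt0.
  have /clf[g [Sg fg]] : nbhs (f : {uniform X -> R[i]^o})
      [set g | forall x, normc (f x - g x) < e / 2].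
    apply/uniform_nbhs; exists [set zw | normc (zw.1 - zw.2) < e / 2]; split.
      rewrite -entourage_from_ballE; exists (e / 2)%:C; first by rewrite /= ltcR.
      by move=> [z w]; rewrite /ball/= lt_normc.
    by move=> g fg x; exact: fg.
  exists g => //; apply: (@le_lt_trans _ _ (e / 2)).
    by apply: sup_norm_le => [|x]; [exact: ltW|exact/ltW/fg].
  by rewrite ltr_pdivrMr// ltr_pMr// ltr1n.
move=> /uniform_nbhs[E []]; rewrite -entourage_from_ballE => -[[e e']].
rewrite /= ltcE/= => /andP[/eqP -> e0] eE EB.
have [g Sg fge] := Sf e e0.
exists g; split => //; apply: EB => x _; apply: eE => /=.
change (`|f x - g x| < e%:C); rewrite lt_normc; apply: le_lt_trans fge.
apply: (@normc_le_sup_norm (f \- g)) => // y.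
by apply: (@continuousB _ R[i]^o); [exact: cf|exact: cS].
Qed.

End sup_norm_theory.

(* Main.v *)
(* A bounded relative unit [h] at [x] that is 1 off a small neighbourhood of [x]
   turns [f] into [f x + h (f - f x)], which is constant near [x], equals [f] off
   that neighbourhood, and is uniformly close to [f].  Running through a
   countable base, one performs such a modification inside the n-th basic open
   set, with error [e / 2 ^ n.+1], unless that set already meets the open set on
   which the current function has been made locally constant.  Since that open
   set is never modified again, the uniform limit is locally constant on the
   union of all these open sets, which meets every basic open set. *)
Require Import Defs.
From HB Require Import structures.
From mathcomp Require Import all_boot all_order all_algebra.
From mathcomp Require Import complex.
From mathcomp Require Import all_classical all_reals.
From mathcomp Require Import topology normedtype.
From mathcomp Require Import ring lra.

Import Order.TTheory GRing.Theory Num.Theory.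
Import numFieldNormedType.Exports.

Local Open Scope classical_set_scope.
Local Open Scope complex_scope.
Local Open Scope ring_scope.

Local Notation normc := ComplexField.Normc.normc.

(** * Limits of sequences with geometrically decreasing increments *)

Lemma geometric_increments_limit (R : realType) (u : nat -> R) (e : R) :
  (forall n, `|u n.+1 - u n| <= e / 2 ^+ n.+1) ->
  exists l, forall n, `|l - u n| <= e / 2 ^+ n.
Proof.
move=> ue; pose t n := e / 2 ^+ n.
have tS n : t n = t n.+1 + t n.+1.
  by rewrite /t exprS invfM mulrCA [2^-1 * _]mulrC -splitr.
have uS n : - t n.+1 <= u n.+1 - u n /\ u n.+1 - u n <= t n.+1.
  by apply/andP; rewrite -ler_norml; exact: ue.
(* By [uS] a number lies between [- t n.+1] and [t n.+1], so [t n.+1] is nonnegative, and [t n] is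
   its double. *)
have t0 n : 0 <= t n by have := uS n; rewrite (tS n); lra.
change (exists l, forall n, `|l - u n| <= t n); clearbody t.
(* [u - t] increases, [u + t] decreases, and the limit lies between them. *)
have incr n k : u n - t n <= u (n + k)%N - t (n + k)%N.
  elim: k => [|k IH]; first by rewrite addn0.
  apply: (le_trans IH); rewrite addnS (tS (n + k)%N).
  by have := uS (n + k)%N; lra.
have decr n k : u (n + k)%N + t (n + k)%N <= u n + t n.
  elim: k => [|k IH]; first by rewrite addn0.
  apply: (le_trans _ IH); rewrite addnS (tS (n + k)%N).
  by have := uS (n + k)%N; lra.
(* The values at [m] and [n] are compared through the common later index [n + m]. *)
have ubd n : ubound (range (fun m => u m - t m)) (u n + t n).
  move=> _ [m _ <-]; have := incr m n; have := decr n m.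
  by rewrite (addnC m); have := t0 (n + m)%N; lra.
exists (sup (range (fun m => u m - t m))) => n.
rewrite ler_norml; apply/andP; split.
  suff: u n - t n <= sup (range (fun m => u m - t m)) by lra.
  apply: sup_upper_bound; last by exists n.
  by split; [exists (u 0%N - t 0%N), 0%N | exists (u 0%N + t 0%N)].
suff: sup (range (fun m => u m - t m)) <= u n + t n by lra.
by apply: ge_sup => //; exists (u 0%N - t 0%N), 0%N.
Qed.

Lemma half_expn_small (R : realType) (c d : R) : 0 < d ->
  exists k, forall n, (k <= n)%N -> c / 2 ^+ n <= d.
Proof.
(* Any [k] above [c / d] works, since [n < 2 ^ n]. *)
move=> d0; exists (Num.truncn (c / d)).+1 => n kn.
rewrite ler_pdivrMr ?exprn_gt0// mulrC -ler_pdivrMr//.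
apply: ltW; apply: lt_le_trans (truncnS_gt _) _.
by rewrite -natrX ler_nat; apply: ltnW; apply: leq_ltn_trans kn (ltn_expl _ _).
Qed.

Lemma normr_Re_le_normc (R : realType) (z : R[i]) : `|complex.Re z| <= normc z.
Proof.
case: z => a b /=; rewrite -sqrtr_sqr ler_sqrt ?lerDl ?sqr_ge0//.
by rewrite addr_ge0 ?sqr_ge0.
Qed.

Lemma normr_Im_le_normc (R : realType) (z : R[i]) : `|complex.Im z| <= normc z.
Proof.
case: z => a b /=; rewrite -sqrtr_sqr ler_sqrt ?lerDr ?sqr_ge0//.
by rewrite addr_ge0 ?sqr_ge0.
Qed.

Lemma normc_ge0 (R : realType) (z : R[i]) : 0 <= normc z.
Proof. by case: z => a b; exact: sqrtr_ge0. Qed.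

Lemma normc_le_ReIm (R : realType) (z : R[i]) :
  normc z <= `|complex.Re z| + `|complex.Im z|.
Proof.
case: z => a b /=.
rewrite -[leRHS]ger0_norm ?addr_ge0// -sqrtr_sqr ler_sqrt ?sqr_ge0//.
rewrite -(real_normK (num_real a)) -(real_normK (num_real b)).
have := mulr_ge0 (normr_ge0 a) (normr_ge0 b); nra.
Qed.

(** Real and imaginary parts converge separately; the factor 2 comes from adding their two
    bounds. *)
Lemma geometric_increments_limitC (R : realType) (u : nat -> R[i]) (e : R) :
  (forall n, normc (u n.+1 - u n) <= e / 2 ^+ n.+1) ->
  exists l, forall n, normc (l - u n) <= 2 * (e / 2 ^+ n).
Proof.
move=> ue.
have [|a ha] := @geometric_increments_limit R (fun n => complex.Re (u n)) e.
  move=> n; apply: le_trans (ue n); rewrite /= -raddfB.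
  exact: normr_Re_le_normc.
have [|b hb] := @geometric_increments_limit R (fun n => complex.Im (u n)) e.
  move=> n; apply: le_trans (ue n); rewrite /= -raddfB.
  exact: normr_Im_le_normc.
exists (a +i* b) => n; apply: le_trans (normc_le_ReIm _ _) _.
rewrite mulr2n mulrDl mul1r; have := hb n; have := ha n => /=.
by case: (u n) => p q /=; exact: lerD.
Qed.

(** * Uniform closure and countable bases *)

(** A pointwise bound, in place of one on [sup_norm], lets this apply to a limit not yet known to be
    continuous; continuity then follows from membership in the closed algebra. *)
Lemma closure_uniform (R : realType) (X : topologicalType)
    (S : set (X -> R[i]^o)) (f : X -> R[i]^o) :
  (forall e : R, 0 < e -> exists2 g, S g & forall x, normc (f x - g x) <= e) ->
  closure (S : set {uniform X -> R[i]^o}) f.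
Proof.
move=> Sf B /uniform_nbhs[E []]; rewrite -entourage_from_ballE => -[[e e']].
rewrite /= ltcE/= => /andP[/eqP -> e0] eE EB.
have [g Sg fge] := Sf (e / 2) (divr_gt0 e0 (ltr0Sn R 1)).
exists g; split => //; apply: EB => x _; apply: eE => /=.
change (`|f x - g x| < e%:C); rewrite lt_normc; apply: le_lt_trans (fge x) _.
by rewrite ltr_pdivrMr// ltr_pMr// ltr1n.
Qed.

Lemma compact_countable_pi_base (R : realType) (X : pseudoMetricType R) :
  compact [set: X] -> exists B : nat -> set X,
    (forall n, open (B n)) /\
    forall O, open O -> O !=set0 -> exists n, B n !=set0 /\ B n `<=` O.
Proof.
move=> cX; have [[x0 _]|X0] := pselect ([set: X] !=set0); last first.
  exists (fun=> set0); split => [n|O _ [x _]]; first exact: open0.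
  by exfalso; apply: X0; exists x.
pose X' := HB.pack_for (pseudoPMetricType R) X (isPointed.Build X x0).
have [D cD [oD bD]] := @compact_second_countable R X' cX.
(* The base [D] has a member around [x0], so it is not empty and some sequence enumerates it. *)
have /pfcard_geP[D0|[B]] := cD.
  by have [U [DU _] _] := bD x0 setT filterT; rewrite D0 in DU.
exists B; split => [n|O oO [x Ox]]; first by apply: oD; exact: funS.
have [U [DU Ux] UO] := bD x O (open_nbhs_nbhs (conj oO Ox)).
have [n _ BU] := @surj _ _ _ _ B _ DU.
by exists n; rewrite BU; split => //; exists x.
Qed.

(** * Local modification of a function and its iteration *)

Section flattening.
Context {R : realType} {X : topologicalType}.
Variable A : set (X -> R[i]^o).
Hypotheses (cX : compact [set: X]) (hA : is_uniform_algebra A).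

Lemma flatten_near (f : X -> R[i]^o) (x : X) (O : set X) (e : R) :
  has_bounded_relative_units A x -> A f -> open O -> O x -> 0 < e ->
  exists g V, [/\ A g, open V /\ V x, locally_constant_on V g,
    forall y, ~ O y -> g y = f y & forall y, normc (g y - f y) <= e].
Proof.
move=> [C C1 hC] Af oO Ox e0.
have C0 : 0 < C + 1 by apply: addr_gt0 => //; exact: lt_le_trans C1.
(* The change made to [f] is [(h - 1) * (f - f x)], and [h - 1] has modulus at most [C + 1]. *)
pose d := e / (C + 1); have d0 : 0 < d by exact: divr_gt0.
pose N := (O `&` [set y | normc (f y - f x) < d])°.
have Nx : N x.
  apply: filterI; first exact: open_nbhs_nbhs.
  have d0' : (0 : R[i]) < d%:C by rewrite ltcR.
  have := ualg_continuous hA Af (x := x).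
  move=> /(@cvgrPdist_lt _ R[i]^o) /(_ _ d0').
  by apply: filterS => y; rewrite distrC lt_normc.
have cE : compact (~` N).
  by apply: (subclosed_compact _ cX) => //; apply: open_closedC; exact: open_interior.
(* With the complement of [N] as compact set, [h] is 1 at every point outside [O] and wherever [f]
   is not within [d] of [f x]. *)
have [|h [[Ah hx] hle h1]] := hC _ cE.
  by move=> y Ny /= yx; apply: Ny; rewrite yx.
pose g : X -> R[i]^o := cst (f x) \+ (h \* (f \+ cst (- f x))).
have gE y : g y = f x + h y * (f y - f x) by [].
exists g, (h @^-1` [set 0])°; split.
- apply: (ualgD hA); first exact: (ualg_cst hA).
  apply: (ualgM hA) => //; apply: (ualgD hA) => //; exact: (ualg_cst hA).
- by split; [exact: open_interior|].
- move=> y hy; have hy0 : h y = 0 by exact: (interior_subset hy).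
  near=> z; have hz0 : h z = 0 by near: z.
  by rewrite !gE hy0 hz0 !mul0r.
- move=> y Oy; have hy1 : h y = 1.
    by apply: h1; exists y => // Ny; apply: Oy; case: (interior_subset Ny).
  by rewrite gE hy1 mul1r addrC subrK.
- move=> y; have -> : g y - f y = (h y - 1) * (f y - f x) by rewrite gE; ring.
  rewrite ComplexField.Normc.normcM.
  have [Ny|Ny] := pselect (N y); last first.
    have -> : h y = 1 by apply: h1; exists y.
    by rewrite subrr ComplexField.Normc.normc0 mul0r ltW.
  have [_ /= fy] := interior_subset Ny.
  have -> : e = (C + 1) * d by rewrite /d mulrC divfK// gt_eqF.
  apply: ler_pM; rewrite ?(ltW fy)//; [exact: normc_ge0|exact: normc_ge0|].
  apply: le_trans (le_normcD _ _) _; rewrite normcN ComplexField.Normc.normc1 lerD2r.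
  apply: le_trans hle; apply: normc_le_sup_norm => //.
  by move=> z; exact: (ualg_continuous hA Ah).
Unshelve. all: by end_near. Qed.

Lemma flatten_on (f : X -> R[i]^o) (W O : set X) (e : R) :
  (exists2 x, O x & has_bounded_relative_units A x) ->
  A f -> open W -> locally_constant_on W f -> open O -> 0 < e ->
  exists g W', [/\ A g, open W', locally_constant_on W' g,
    [/\ W `<=` W', O `&` W' !=set0 & forall y, W y -> g y = f y] &
    forall y, normc (g y - f y) <= e].
Proof.
move=> [x Ox hx] Af oW lW oO e0.
have [OW|OW] := pselect (O `&` W !=set0).
  exists f, W; split => // [|y]; first by split.
  by rewrite subrr ComplexField.Normc.normc0 ltW.
have [g [V [Ag [oV Vx] lV gf gfe]]] := flatten_near _ _ _ _ hx Af oO Ox e0.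
(* [O] and [W] are disjoint in this case, so a change confined to [O] leaves [f] intact on [W]. *)
have gW y : W y -> g y = f y by move=> Wy; apply: gf => Oy; apply: OW; exists y.
exists g, (W `|` V); split => //.
- exact: openU.
- move=> y [Wy|Vy]; last exact: lV.
  have nW : nbhs y W by exact: open_nbhs_nbhs.
  near=> z; rewrite (gW y)// (gW z); last by near: z.
  by near: z; exact: lW.
- by split; [exact: subsetUl|exists x; split => //; right|].
Unshelve. all: by end_near. Qed.

Lemma A_lc_approx (B : nat -> set X) (f : X -> R[i]^o) (e : R) :
  (forall n, open (B n)) ->
  (forall O, open O -> O !=set0 -> exists n, B n !=set0 /\ B n `<=` O) ->
  (forall n, B n !=set0 ->
    exists2 x, B n x & has_bounded_relative_units A x) ->
  A f -> 0 < e ->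
  exists2 g, A_lc A g & forall x, normc (f x - g x) <= 2 * e.
Proof.
move=> oB bB hB Af e0.
(* A state holds the stage number, the current function and the open set on which it is locally
   constant. *)
pose inv (s : nat * ((X -> R[i]^o) * set X)) :=
  [/\ A s.2.1, open s.2.2 & locally_constant_on s.2.2 s.2.1].
(* Dependent choice asks every state for a successor, so [step] is made vacuous on states that
   violate [inv]. *)
pose step s s' := inv s -> [/\ inv s', s'.1 = s.1.+1,
  [/\ s.2.2 `<=` s'.2.2, B s.1 !=set0 -> B s.1 `&` s'.2.2 !=set0 &
      forall y, s.2.2 y -> s'.2.1 y = s.2.1 y] &
  forall y, normc (s'.2.1 y - s.2.1 y) <= e / 2 ^+ s.1.+1].
have stepE s : {s' | step s s'}.
  apply: cid; have [invS|ninvS] := pselect (inv s); last by exists s.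
  (* An empty [B n] offers no point to flatten at; only the stage number advances. *)
  have [Bn|Bn] := pselect (B s.1 !=set0); last first.
    exists (s.1.+1, s.2) => _; split => // [|y]; first by split.
    by rewrite subrr ComplexField.Normc.normc0 divr_ge0 ?ltW ?exprn_gt0.
  have [As oW lW] := invS.
  have e'0 : 0 < e / 2 ^+ s.1.+1 by rewrite divr_gt0 ?exprn_gt0.
  have [g [W' [Ag oW' lW' [WW' BW' gf] ge]]] :=
    flatten_on _ _ _ _ (hB _ Bn) As oW lW (oB _) e'0.
  by exists (s.1.+1, (g, W')) => _; split.
have [s [s0 sS]] := dependent_choice stepE (0%N, (f, set0)).
have invs n : inv (s n).
  elim: n => [|n IH]; last by have [] := sS n IH.
  by rewrite s0; split => //=; exact: open0.
have sn n : (s n).1 = n.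
  by elim: n => [|n IH]; [rewrite s0|have [_ -> _ _] := sS n (invs n); rewrite IH].
pose u n := (s n).2.1; pose W n := (s n).2.2.
have uS n y : normc (u n.+1 y - u n y) <= e / 2 ^+ n.+1.
  by have [_ _ _ /(_ y)] := sS n (invs n); rewrite sn.
have [g gu] := choice (fun y => geometric_increments_limitC _ _ _ (uS ^~ y)).
have Wadd n k : W n `<=` W (n + k)%N.
  elim: k => [|k IH]; first by rewrite addn0.
  rewrite addnS; apply: (subset_trans IH).
  by have [_ _ [? _ _] _] := sS (n + k)%N (invs _).
have uW n k y : W n y -> u (n + k)%N y = u n y.
  move=> Wy; elim: k => [|k IH]; first by rewrite addn0.
  rewrite addnS -IH; have [_ _ [_ _ Wu] _] := sS (n + k)%N (invs _).
  by apply: Wu; exact: Wadd Wy.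
(* On [W n] the sequence is stationary from index [n] on, so the error bounds at all indices [n + k]
   apply to the same difference and force it to vanish. *)
have gW n y : W n y -> g y = u n y.
  move=> Wy; apply/eqP; rewrite -subr_eq0; apply/eqP.
  apply: ComplexField.Normc.eq0_normc; apply/eqP.
  rewrite eq_le normc_ge0 andbT; apply/ler_addgt0Pr => d d0; rewrite add0r.
  have [k /(_ (n + k)%N (leq_addl n k)) kd] := half_expn_small _ (2 * e) _ d0.
  by apply: le_trans kd; rewrite -(uW n k)// -mulrA; exact: gu.
exists g; last first.
  move=> y; rewrite -(normcN (f y - g y : Rcomplex R)) opprB.
  by have := gu y 0%N; rewrite /u s0 expr0 divr1.
split.
  apply: (ualg_closed hA); apply: closure_uniform => d d0.
  have [k /(_ k (leqnn k)) kd] := half_expn_small _ (2 * e) _ d0.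
  exists (u k); first by have [] := invs k.
  by move=> y; apply: le_trans (gu y k) _; rewrite mulrA.
exists (\bigcup_n W n); split.
- by apply: bigcup_open => n _; have [] := invs n.
- move=> O O0 oO; have [n [Bn BO]] := bB O oO O0.
  have [_ _ [_ BW _] _] := sS n (invs n).
  rewrite sn in BW; have [x [Bx Wx]] := BW Bn.
  (* Step [n] treats [B n] and produces [W n.+1], hence the shift. *)
  by exists x; split; [exact: BO|exists n.+1].
- move=> y [n _ Wy]; have [_ oW lW] := invs n.
  have nW : nbhs y (W n) by exact: open_nbhs_nbhs.
  near=> z; rewrite (gW n y)// (gW n z); last by near: z.
  by near: z; exact: lW.
Unshelve. all: by end_near. Qed.
End flattening.

Theorem theorem4p2 (R : realType) (X : metricType R)
    (cX : compact [set: X])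
    (A : set (X -> R[i]^o)) (hA : is_uniform_algebra A)
    (Y : set X) (dY : dense Y)
    (hY : forall x, Y x -> has_bounded_relative_units A x) :
  A `<=` closure (A_lc A : set {uniform X -> R[i]^o}).
Proof.
move=> f Af; apply: closure_uniform => e e0.
have [B [oB bB]] := compact_countable_pi_base _ _ cX.
have hB n : B n !=set0 -> exists2 x, B n x & has_bounded_relative_units A x.
  move=> Bn; have [x [Bx Yx]] := dY _ Bn (oB n).
  by exists x => //; exact: hY.
(* Halving [e] absorbs the factor 2 of the complex limit. *)
have e20 : 0 < e / 2 by rewrite divr_gt0.
have [g lg fg] := A_lc_approx _ cX hA _ _ _ oB bB hB Af e20.
by exists g => // x; apply: le_trans (fg x) _; lra.
Qed.
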